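(* Let $n\ge 2$ be an integer, let $K$ be a field containing $n$ distinct $n$-th roots of $1$, let $R=K[x,y,z]$, and let $I=(f_1,f_2,f_3)$ with $f_1=x(y^n-z^n)$, $f_2=y(z^n-x^n)$, $f_3=z(x^n-y^n)$. Let $S=R[T_1,T_2,T_3]$ be bigraded by $\deg x=\deg y=\deg z=(1,0)$ and $\deg T_i=(n+1,1)$. Then the Rees algebra $\mathcal{R}(I)$ is a complete intersection: the kernel $L$ of the $R$-algebra epimorphism $S\to\mathcal{R}(I)$, $T_i\mapsto f_it$, is generated by two bihomogeneous forms, of bidegrees $(n+3,1)$ and $(2n,1)$, and $L$ has height two.
   Context: The Rees algebra of $I$ is $\mathcal{R}(I)=\bigoplus_{i\ge 0}I^it^i\subseteq R[t]$. ''Complete intersection'' means that $\mathcal{R}(I)\cong S/L$ where the number of generators of $L$ equals its height (equivalently, the generators form a regular sequence). *)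

(* Defs.v *)
From HB Require Import structures.
From mathcomp Require Import all_boot all_order all_algebra.
From mathcomp Require Import ring_quotient.
From mathcomp Require Import mpoly.

Set Implicit Arguments.
Unset Strict Implicit.
Unset Printing Implicit Defensive.

Import GRing.Theory.
Local Open Scope ring_scope.

Section Ideals.
Variable A : comNzRingType.

Definition ideal_gen (G : A -> Prop) (p : A) : Prop :=
  exists2 s : seq (A * A), (forall u, u \in s -> G u.2)
                         & p = \sum_(u <- s) u.1 * u.2.

Definition ideal_pow (I : A -> Prop) (k : nat) : A -> Prop :=
  ideal_gen (fun q => exists2 c : 'I_k -> A, (forall i, I (c i))
                                           & q = \prod_i c i).

(* [idealr_closed] already requires the ideal to be proper. *)
Definition prime_ideal (P : {pred A}) : Prop :=
  idealr_closed P /\ prime_idealr_closed P.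

(* There is a chain C 0 < C 1 < ... < C h = P of prime ideals; only the first
   h + 1 values of C matter. *)
Definition height_prime_ge (P : {pred A}) (h : nat) : Prop :=
  exists C : nat -> {pred A},
    [/\ forall i, (i <= h)%N -> prime_ideal (C i),
        forall i, (i < h)%N -> {subset C i <= C i.+1} /\
                               (exists2 p, p \in C i.+1 & p \notin C i)
      & C h =i P].

(* The height of I is the minimum of the heights of the primes containing I;
   the unit ideal has no height in this sense. *)
Definition height_eq (I : {pred A}) (h : nat) : Prop :=
  (forall P : {pred A}, prime_ideal P -> {subset I <= P} ->
     height_prime_ge P h) /\
  (exists P : {pred A},
     [/\ prime_ideal P, {subset I <= P} & ~ height_prime_ge P h.+1]).

End Ideals.

Section Rees.
Variable R : comNzRingType.

(* As a subset of R[t], where t is the variable of {poly R}. *)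
Definition rees_algebra (I : R -> Prop) (q : {poly R}) : Prop :=
  forall i, ideal_pow I i q`_i.

(* The R-algebra map R[T_1, ..., T_m] -> R[t] sending T_i to a i. *)
Definition alg_map m (a : 'I_m -> {poly R}) : {mpoly R[m]} -> {poly R} :=
  mmap (@polyC R) a.

Definition alg_ker m (a : 'I_m -> {poly R}) : {pred {mpoly R[m]}} :=
  [pred p | alg_map a p == 0].

Definition presents m (a : 'I_m -> {poly R}) (B : {poly R} -> Prop) : Prop :=
  forall q, B q <-> exists p, alg_map a p = q.

(* B is isomorphic to S/L, with S a polynomial ring over R and L generated by
   as many elements as its height. This is the usual notion when R is itself
   a polynomial ring over a field. *)
Definition complete_intersection (B : {poly R} -> Prop) : Prop :=
  exists m (a : 'I_m -> {poly R}) (gs : seq {mpoly R[m]}),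
    [/\ presents a B,
        forall p, p \in alg_ker a <-> ideal_gen (fun g => g \in gs) p
      & height_eq (alg_ker a) (size gs)].

Definition rees_gens m (f : 'I_m -> R) : 'I_m -> {poly R} :=
  fun i => f i *: 'X.

End Rees.

(* For deg x_i = (1,0) and deg T_j = (w,1), a nonzero form of bidegree (d,e):
   each T-monomial m of g has degree e, and its coefficient, of degree k in
   the x_i, contributes k + w * deg m = d to the first component. *)
Definition bihomog (K : fieldType) (r s w d e : nat)
    (g : {mpoly {mpoly K[r]}[s]}) : Prop :=
  g != 0 /\
  forall m, m \in msupp g ->
    mdeg m = e /\
    exists2 k : nat, g@_m \is k.-homog & (k + w * mdeg m)%N = d.

Section Fermat.
Variables (K : fieldType) (n : nat).

Definition fermat_gens : 'I_3 -> {mpoly K[3]} :=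
  let x : {mpoly K[3]} := 'X_(inord 0) in
  let y : {mpoly K[3]} := 'X_(inord 1) in
  let z : {mpoly K[3]} := 'X_(inord 2) in
  tnth [tuple x * (y ^+ n - z ^+ n);
              y * (z ^+ n - x ^+ n);
              z * (x ^+ n - y ^+ n)].

Definition fermat_ideal : {mpoly K[3]} -> Prop :=
  ideal_gen (fun q => exists i, q = fermat_gens i).

(* T_i |-> f_i t *)
Definition fermat_rees_gens : 'I_3 -> {poly {mpoly K[3]}} :=
  rees_gens fermat_gens.

End Fermat.

Arguments fermat_gens K n : clear implicits.
Arguments fermat_ideal K n : clear implicits.
Arguments fermat_rees_gens K n : clear implicits.

(* Main.v *)
From HB Require Import structures.
Require Import Defs.
From mathcomp Require Import all_boot all_order all_algebra.
From mathcomp Require Import ring_quotient mpoly.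
From mathcomp Require Import ring zify.

(* Put n = m + 1. The syzygies g1 = yz T_1 + xz T_2 + xy T_3 and
   g2 = x^m T_1 + y^m T_2 + z^m T_3 of (f1, f2, f3) generate L.  The minors
   f1 T_i - f_i T_1 lie in J = (g1, g2), so a power of f1 carries L into J, and
   f1 is regular modulo J: it is a product of linear forms l in x, y, z over
   the n-th roots of unity, and modulo each of them z^m g1 is congruent to
   f2 T_1 modulo g2, where f2 T_1 is again a product of linear forms, none of
   which divides g2.
   The chain 0 < Q < L, where Q is the kernel of the parametrization
   (T_1, T_2, T_3) |-> (x s, y t, - z (s + t)) of the solutions of g1 = 0,
   gives height at least 2.  A chain C 0 < C 1 < C 2 < C 3 = L of primes would
   make T_1 and elements of C 3, C 2, C 1 outside the preceding prime
   algebraically independent over R = K[x, y, z], but R[T_1, T_2, T_3] contains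
   no four such elements. *)

Set Implicit Arguments.
Unset Strict Implicit.
Unset Printing Implicit Defensive.

Import GRing.Theory.
Local Open Scope ring_scope.

(** * Ideals and the image of the Rees map *)

Section IdealGen.
Variable A : comNzRingType.
Implicit Types (G : A -> Prop) (p q : A).

Lemma ideal_gen0 G : ideal_gen G 0.
Proof. by exists [::] => //; rewrite big_nil. Qed.

Lemma ideal_genD G p q : ideal_gen G p -> ideal_gen G q -> ideal_gen G (p + q).
Proof.
move=> [s sG ->] [t tG ->]; exists (s ++ t); last by rewrite big_cat.
by move=> u; rewrite mem_cat => /orP[/sG|/tG].
Qed.

Lemma ideal_genM G a p : ideal_gen G p -> ideal_gen G (a * p).
Proof.
move=> [s sG ->]; exists [seq (a * u.1, u.2) | u <- s].
  by move=> _ /mapP[u us ->]; exact: (sG u).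
by rewrite big_map mulr_sumr; apply: eq_bigr => u _; rewrite mulrA.
Qed.

Lemma ideal_gen_mem G p : G p -> ideal_gen G p.
Proof.
move=> Gp; exists [:: (1, p)]; last by rewrite big_seq1 mul1r.
by move=> u; rewrite inE => /eqP->.
Qed.

Lemma ideal_gen_sum G (I : Type) (r : seq I) (P : pred I) (F : I -> A) :
  (forall i, P i -> ideal_gen G (F i)) -> ideal_gen G (\sum_(i <- r | P i) F i).
Proof.
by move=> GF; apply: big_ind; [exact: ideal_gen0 | exact: ideal_genD | exact: GF].
Qed.

Lemma ideal_gen_ind G (I : A -> Prop) :
    (forall q, G q -> I q) -> I 0 -> (forall a q, I q -> I (a * q)) ->
    (forall q r, I q -> I r -> I (q + r)) ->
  forall p, ideal_gen G p -> I p.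
Proof.
move=> GI I0 IM ID p [s sG ->].
elim: s sG => [|u s IHs] sG; first by rewrite big_nil.
rewrite big_cons; apply: ID; first by apply/IM/GI/sG; rewrite mem_head.
by apply: IHs => v vs; apply: sG; rewrite inE vs orbT.
Qed.

Lemma ideal_gen2P (g1 g2 p : A) :
  ideal_gen (fun g => g \in [:: g1; g2]) p <->
  exists a b, p = a * g1 + b * g2.
Proof.
split.
  move: p; apply: ideal_gen_ind => [q||c q [a [b ->]]|q r [a [b ->]] [a' [b' ->]]].
  - rewrite !inE => /orP[]/eqP->.
      by exists 1, 0; rewrite mul1r mul0r addr0.
    by exists 0, 1; rewrite mul1r mul0r add0r.
  - by exists 0, 0; rewrite !mul0r addr0.
  - by exists (c * a), (c * b); rewrite mulrDr !mulrA.
  - by exists (a + a'), (b + b'); ring.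
move=> [a [b ->]]; apply: ideal_genD; apply: ideal_genM; apply: ideal_gen_mem.
  by rewrite !inE eqxx.
by rewrite !inE eqxx orbT.
Qed.

Lemma ideal_pow0 (I : A -> Prop) p : ideal_pow I 0 p.
Proof.
rewrite -[p]mulr1; apply/ideal_genM/ideal_gen_mem.
by exists (fun=> 1) => [[]|] //; rewrite big_ord0.
Qed.

Lemma ideal_pow1 (I : A -> Prop) p : I p -> ideal_pow I 1 p.
Proof.
by move=> Ip; apply: ideal_gen_mem; exists (fun=> p) => //; rewrite big_ord1.
Qed.

Lemma ideal_powM (I : A -> Prop) i j p q :
  ideal_pow I i p -> ideal_pow I j q -> ideal_pow I (i + j) (p * q).
Proof.
move=> Ip Iq; move: p Ip; apply: ideal_gen_ind => [_ [c Ic ->]||a p|p p'].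
- move: q Iq; apply: ideal_gen_ind => [_ [d Id ->]||a q|q q'].
  + apply: ideal_gen_mem.
    exists (fun k => match split k with inl i => c i | inr j => d j end).
      by move=> k; case: (split k).
    rewrite big_split_ord /=; congr (_ * _); apply: eq_bigr => k _.
      by rewrite (unsplitK (inl k)).
    by rewrite (unsplitK (inr k)).
  + by rewrite mulr0; apply: ideal_gen0.
  + by rewrite mulrCA; apply: ideal_genM.
  + by rewrite mulrDr; apply: ideal_genD.
- by rewrite mul0r; apply: ideal_gen0.
- by rewrite -mulrA; apply: ideal_genM.
- by rewrite mulrDl; apply: ideal_genD.
Qed.

End IdealGen.

Section AlgMap.
Variables (R : comNzRingType) (m : nat) (a : 'I_m -> {poly R}).

HB.instance Definition _ := GRing.RMorphism.copy (alg_map a) (mmap (@polyC R) a).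

Lemma alg_mapC c : alg_map a c%:MP = c%:P.
Proof. exact: mmapC. Qed.

Lemma alg_mapX i : alg_map a 'X_i = a i.
Proof. by rewrite /alg_map mmapX mmap1U. Qed.

Lemma alg_mapZ c p : alg_map a (c *: p) = c%:P * alg_map a p.
Proof. exact: mmapZ. Qed.

End AlgMap.

Section Rees.
Variables (R : comNzRingType) (m : nat) (f : 'I_m -> R).
Let I := ideal_gen (fun q => exists i, q = f i).

Lemma rees_algebraD p q :
  rees_algebra I p -> rees_algebra I q -> rees_algebra I (p + q).
Proof. by move=> Ip Iq i; rewrite coefD; apply: ideal_genD; [exact: Ip|exact: Iq]. Qed.

Lemma rees_algebraM p q :
  rees_algebra I p -> rees_algebra I q -> rees_algebra I (p * q).
Proof.
move=> Ip Iq i; rewrite coefM; apply: ideal_gen_sum => j _.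
by have := ideal_powM (Ip j) (Iq (i - j)%N); rewrite subnKC // -ltnS.
Qed.

Lemma rees_algebraC c : rees_algebra I c%:P.
Proof.
move=> [|i]; rewrite coefC; first exact: ideal_pow0.
exact: ideal_gen0.
Qed.

Lemma rees_algebra_gen i : rees_algebra I (rees_gens f i).
Proof.
move=> k; rewrite coefZ coefX; case: k => [|[|k]]; last 2 first.
- by rewrite /= mulr1; apply: ideal_pow1; apply: ideal_gen_mem; exists i.
- by rewrite mulr0; apply: ideal_gen0.
exact: ideal_pow0.
Qed.

(** Constants and the f_i t lie in the Rees algebra, which is closed under sums and products.
    Conversely q is lifted term by term: an element of I^k times t^k is an R-combination of products
    of k elements of I t, and each of these lifts to an R-combination of the T_i. *)
Lemma presents_rees : presents (rees_gens f) (rees_algebra I).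
Proof.
move=> q; split; last first.
  move=> [p <-]; elim/mpolyind: p => [|c mm p _ _ IHp].
    by rewrite raddf0; apply: (rees_algebraC 0).
  rewrite rmorphD /= alg_mapZ; apply/rees_algebraD => //.
  apply: rees_algebraM; first exact: rees_algebraC.
  rewrite /alg_map mmapX /mmap1.
  apply: big_ind => [||i _]; [exact: rees_algebraC | exact: rees_algebraM|].
  elim: (mm i) => [|k IHk]; first exact: rees_algebraC.
  by rewrite exprS; apply: rees_algebraM => //; apply: rees_algebra_gen.
move=> Iq; rewrite -[q]coefK poly_def.
suff H k c : ideal_pow I k c -> exists p, alg_map (rees_gens f) p = c *: 'X^k.
  elim: (size q) => [|k [p IHp]]; first by exists 0; rewrite big_ord0 raddf0.
  have [p' Hp'] := H k _ (Iq k).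
  by exists (p + p'); rewrite big_ord_recr /= rmorphD /= IHp Hp'.
move: c; apply: ideal_gen_ind => [_ [d Id ->]||a p [p' Hp']|p p' [r Hr] [r' Hr']].
- elim: k d Id => [|k IHk] d Id.
    by exists 1; rewrite big_ord0 rmorph1 scale1r.
  have [p Hp] := IHk (fun i => d (widen_ord (leqnSn k) i)) (fun i => Id _).
  have [p' Hp'] : exists p, alg_map (rees_gens f) p = d ord_max *: 'X.
    move: (d ord_max) (Id ord_max).
    apply: ideal_gen_ind => [_ [i ->]||a r [r' Hr']|r r' [s Hs] [s' Hs']].
    + by exists 'X_i; rewrite alg_mapX.
    + by exists 0; rewrite raddf0 scale0r.
    + by exists (a *: r'); rewrite alg_mapZ Hr' mul_polyC scalerA.
    + by exists (s + s'); rewrite rmorphD /= Hs Hs' scalerDl.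
  exists (p * p'); rewrite rmorphM /= Hp Hp' big_ord_recr /= exprSr.
  by rewrite -scalerAl -scalerAr scalerA.
- by exists 0; rewrite raddf0 scale0r.
- by exists (a *: p'); rewrite alg_mapZ Hp' mul_polyC scalerA.
- by exists (r + r'); rewrite rmorphD /= Hr Hr' scalerDl.
Qed.

End Rees.

(** * Regular elements modulo an ideal with two generators *)

Section Regularity.
Variable S : idomainType.
Implicit Types (l g P Q : S) (s : {rmorphism S -> S}).

(** Such an s has kernel exactly (l), so it identifies S/l with the subring s(S), which is a
    domain. *)
Definition retraction_mod l s := s l = 0 /\ forall a, exists c, a = s a + l * c.

(** The second clause says that g is regular modulo P. It replaces the absence of a common factor,
    so that unique factorization is never invoked. *)
Definition coprime_to g P :=
  P != 0 /\ forall b, (exists c, b * g = c * P) -> exists c, b = c * P.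

Lemma coprime_toM g P Q :
  coprime_to g P -> coprime_to g Q -> coprime_to g (P * Q).
Proof.
move=> [P0 gP] [Q0 gQ]; split=> [|b [c bg]]; first by rewrite mulf_neq0.
have [|b' b'E] := gP b; first by exists (c * Q); rewrite bg; ring.
have [|b'' b''E] := gQ b'; last by exists b''; rewrite b'E b''E; ring.
by exists c; apply: (mulIf P0); rewrite mulrAC -b'E bg; ring.
Qed.

Lemma coprime_to_prod g (I : Type) (r : seq I) (F : I -> S) :
  (forall i, coprime_to g (F i)) -> coprime_to g (\prod_(i <- r) F i).
Proof.
move=> gF; apply: big_ind => [||i _]; [|exact: coprime_toM|exact: gF].
by split=> [|b _]; [exact: oner_neq0 | exists b; rewrite mulr1].
Qed.

Lemma coprime_to_unit g P : P \is a GRing.unit -> coprime_to g P.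
Proof.
move=> uP; split=> [|b _]; last by exists (b / P); rewrite divrK.
by apply: contraTneq uP => ->; rewrite unitr0.
Qed.

(** The copy s(S) of S/P is a domain, and g has a nonzero image in it. *)
Lemma coprime_to_retraction g P s :
  retraction_mod P s -> P != 0 -> s g != 0 -> coprime_to g P.
Proof.
move=> [sP rP] P0 sg; split=> // b [c bg].
have [d ->] := rP b; exists d.
suff -> : s b = 0 by rewrite add0r mulrC.
apply/eqP; have /eqP := congr1 s bg.
by rewrite !rmorphM sP mulr0 mulf_eq0 (negbTE sg) orbF.
Qed.

Definition regular_mod g1 g2 l := forall p,
  (exists a b, l * p = a * g1 + b * g2) -> exists a b, p = a * g1 + b * g2.

Lemma regular_modM g1 g2 l l' :
  regular_mod g1 g2 l -> regular_mod g1 g2 l' -> regular_mod g1 g2 (l * l').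
Proof. by move=> rl rl' p; rewrite -mulrA => /rl/rl'. Qed.

Lemma regular_mod1 g1 g2 : regular_mod g1 g2 1.
Proof. by move=> p; rewrite mul1r. Qed.

(* On the domain S/l the forms s g1 and s g2 have no common factor: up to
   multiples of s g2, a multiple of s g1 is coprime to s g2. *)
Lemma regular_mod_retraction g1 g2 l s u w P :
    retraction_mod l s -> l != 0 -> s g2 != 0 ->
    u * s g1 = P + w * s g2 -> coprime_to (s g2) P ->
  regular_mod g1 g2 l.
Proof.
move=> [sl rl] l0 g20 ug1 [P0 g2P] p [A [B lp]].
have s0 : s A * s g1 + s B * s g2 = 0.
  by rewrite -!rmorphM -rmorphD -lp rmorphM sl mul0r.
have AP : s A * P = - (s A * w + u * s B) * s g2.
  have -> : P = u * s g1 - w * s g2 by rewrite ug1; ring.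
  have -> : s A * (u * s g1 - w * s g2) =
    u * (s A * s g1 + s B * s g2) - u * s B * s g2 - s A * w * s g2 by ring.
  by rewrite s0; ring.
have [|c cE] := g2P (- (s A * w + u * s B)); first by exists (s A).
have sA : s A = c * s g2.
  by apply: (mulIf P0); rewrite AP cE; ring.
have sB : s B = - c * s g1.
  apply: (mulIf g20); apply/eqP; rewrite -subr_eq0; apply/eqP.
  rewrite -[RHS]s0 sA; ring.
(* Modulo l the pair (A, B) is c times the trivial syzygy (g2, -g1). Subtracting c (g2, -g1) from
   (A, B) leaves the value of the combination unchanged and makes both coefficients divisible by l,
   which then cancels. *)
have [A' AE] := rl A; have [B' BE] := rl B.
have [h1 g1E] := rl g1; have [h2 g2E] := rl g2.
exists (A' - c * h2), (B' + c * h1); apply: (mulfI l0).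
rewrite lp [in LHS]AE [in LHS]BE sA sB.
have -> : s g2 = g2 - l * h2 by rewrite [X in X - _]g2E addrK.
have -> : s g1 = g1 - l * h1 by rewrite [X in X - _]g1E addrK.
by ring.
Qed.

End Regularity.

(** * Factorization of a^n - b^n by roots of unity *)

Section PowerFactorization.
Variables (R : idomainType) (rs : seq R).
Hypotheses (urs : uniq rs) (rs_root : forall r, r \in rs -> r ^+ (size rs) = 1).
Hypothesis rs_gt0 : (0 < size rs)%N.

(** For b nonzero, X^n - b^n and the product of the X - r b are both monic of degree n, so their
    difference has degree less than n; it vanishes at the n distinct points r b, hence is 0. For b =
    0 these points coincide and both sides are a^n. *)
Lemma subrXX_prod (a b : R) :
  a ^+ size rs - b ^+ size rs = \prod_(r <- rs) (a - r * b).
Proof.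
have [->|b0] := eqVneq b 0.
  rewrite expr0n gtn_eqF // subr0 (eq_bigr (fun=> a)) => [|r _].
    by rewrite big_const_seq count_predT iter_mulr_1.
  by rewrite mulr0 subr0.
pose q := \prod_(c <- [seq r * b | r <- rs]) ('X - c%:P).
suff /eqP : 'X^(size rs) - (b ^+ size rs)%:P - q == 0.
  rewrite /q big_map => /(congr1 (horner^~ a)).
  rewrite !hornerE horner_prod => /eqP; rewrite subr_eq0 => /eqP->.
  by apply: eq_bigr => r _; rewrite !hornerE.
apply: contraT => p0; suff: (size rs < size rs)%N by rewrite ltnn.
rewrite -[X in (X < _)%N](size_map ( *%R^~ b)).
apply: leq_trans (max_poly_roots p0 _ _) _.
- apply/allP => _ /mapP[r rrs ->]; rewrite rootE !hornerE.
  rewrite exprMn (rs_root rrs) mul1r subrr sub0r oppr_eq0 -rootE.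
  by rewrite root_prod_XsubC; apply/mapP; exists r.
- by rewrite map_inj_uniq // => r r'; apply: mulIf.
have sq : size q = (size rs).+1 by rewrite size_prod_XsubC size_map.
have /monicP : q \is monic by apply: monic_prod_XsubC.
rewrite lead_coefE sq /= => q1.
apply/leq_sizeP => j; rewrite leq_eqVlt => /orP[/eqP<-|ltj].
  by rewrite !coefB coefXn coefC eqxx gtn_eqF // subr0 q1 subrr.
rewrite !coefB coefXn coefC gtn_eqF // gtn_eqF ?(leq_ltn_trans _ ltj) //.
by rewrite nth_default ?sq // !subr0.
Qed.

End PowerFactorization.

(** * Congruences modulo an ideal and saturation of the Rees kernel *)

Section IdealCongr.
Variables (A : comNzRingType) (G : A -> Prop).

Lemma ideal_congrM u u' v v' :
  ideal_gen G (u - v) -> ideal_gen G (u' - v') -> ideal_gen G (u * u' - v * v').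
Proof.
move=> Guv Guv'; have -> : u * u' - v * v' = u' * (u - v) + v * (u' - v') by ring.
by apply: ideal_genD; apply: ideal_genM.
Qed.

Lemma ideal_congrX u v k : ideal_gen G (u - v) -> ideal_gen G (u ^+ k - v ^+ k).
Proof.
move=> Guv; elim: k => [|k IHk]; first by rewrite subrr; apply: ideal_gen0.
by rewrite !exprS; apply: ideal_congrM.
Qed.

Lemma ideal_congr_prod (I : Type) (r : seq I) (E F : I -> A) :
    (forall i, ideal_gen G (E i - F i)) ->
  ideal_gen G (\prod_(i <- r) E i - \prod_(i <- r) F i).
Proof.
move=> EF; elim: r => [|i r IHr]; first by rewrite !big_nil subrr; apply: ideal_gen0.
by rewrite !big_cons; apply: ideal_congrM.
Qed.

End IdealCongr.

Section ReesKernel.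
Variables (R : comNzRingType) (m : nat) (f : 'I_m -> R) (i0 : 'I_m).
Variable G : {mpoly R[m]} -> Prop.
Hypothesis minorsG :
  forall i, ideal_gen G ((f i0)%:MP * 'X_i - (f i)%:MP * 'X_i0).

(** Modulo G the minors give f_i0 T_i = f_i T_i0, so multiplying a monomial of degree d by f_i0^d
    turns each T_i into f_i T_i0. A high multiple f_i0^M p thus depends only on the coefficients of
    the image of p, which are 0 on the kernel. *)
Lemma rees_kernel_saturated p :
  p \in alg_ker (rees_gens f) -> exists N, ideal_gen G ((f i0)%:MP ^+ N * p).
Proof.
rewrite inE => /eqP p0.
(* The claim is made for every p and every large M, so that in the induction two summands can share
   one exponent. *)
suff [N /(_ N (leqnn N))] : exists N, forall M, (N <= M)%N ->
    ideal_gen G ((f i0)%:MP ^+ M * p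
      - \sum_(k < M) ((alg_map (rees_gens f) p)`_k)%:MP
                       * (f i0)%:MP ^+ (M - k) * 'X_i0 ^+ k).
  rewrite p0 big1 ?subr0 => [|k _]; first by exists N.
  by rewrite coef0 mpolyC0 !mul0r.
elim/mpolyind: p {p0} => [|c mm p _ _ [N IHN]].
  exists 0%N => M _; rewrite raddf0 mulr0 sub0r big1 ?oppr0; first exact: ideal_gen0.
  by move=> k _; rewrite coef0 mpolyC0 !mul0r.
(* The successor makes [mdeg mm] one of the indices k < M. *)
exists (maxn (mdeg mm).+1 N) => M; rewrite geq_max => /andP[mM NM].
rewrite rmorphD /= alg_mapZ.
have -> : alg_map (rees_gens f) 'X_[mm]
        = (\prod_(i < m) f i ^+ mm i) *: 'X^(mdeg mm).
  rewrite /alg_map mmapX /mmap1 mdegE -[in RHS]prodrXr.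
  rewrite -mul_polyC rmorph_prod /= -big_split /=; apply: eq_bigr => i _.
  by rewrite /rees_gens -mul_polyC exprMn rmorphXn.
rewrite mul_polyC scalerA.
have -> : \sum_(k < M)
     (((c * \prod_(i < m) f i ^+ mm i) *: 'X^(mdeg mm)
        + alg_map (rees_gens f) p)`_k)%:MP *
     (f i0)%:MP ^+ (M - k) * 'X_i0 ^+ k
   = (c * \prod_(i < m) f i ^+ mm i)%:MP * (f i0)%:MP ^+ (M - mdeg mm) * 'X_i0 ^+ mdeg mm
   + \sum_(k < M)
     ((alg_map (rees_gens f) p)`_k)%:MP *
     (f i0)%:MP ^+ (M - k) * 'X_i0 ^+ k :> {mpoly R[m]}.
  rewrite (bigD1 (Ordinal mM)) //= [in RHS](bigD1 (Ordinal mM)) //= addrA.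
  rewrite coefD coefZ coefXn eqxx mulr1 mpolyCD -!mulrA mulrDl; congr (_ + _).
  apply: eq_bigr => k kmm; rewrite coefD coefZ coefXn.
  suff /negbTE -> : (k : nat) != mdeg mm by rewrite mulr0 add0r.
  by apply: contra kmm => /eqP kE; apply/eqP/val_inj.
rewrite mulrDr opprD addrACA; apply: ideal_genD; last exact: IHN.
rewrite -mul_mpolyC mpolyCM.
set F := (f i0)%:MP; set P := (X in _ * X * _ * _).
have -> : F ^+ M = F ^+ (M - mdeg mm) * F ^+ mdeg mm.
  by rewrite -exprD subnK // ltnW.
have -> : F ^+ (M - mdeg mm) * F ^+ mdeg mm * (c%:MP * 'X_[mm])
    - c%:MP * P * F ^+ (M - mdeg mm) * 'X_i0 ^+ mdeg mm
  = c%:MP * F ^+ (M - mdeg mm) * (F ^+ mdeg mm * 'X_[mm] - P * 'X_i0 ^+ mdeg mm).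
  by ring.
apply: ideal_genM.
rewrite /P mpolyXE_id mdegE -2!prodrXr rmorph_prod /= -!big_split /=.
apply: ideal_congr_prod => i; rewrite rmorphXn /= -!exprMn.
exact: ideal_congrX.
Qed.

End ReesKernel.

(** * Retractions of polynomial rings *)

Section Retractions.

(** The elements congruent to their image under s modulo l form a subring, so constants and
    variables suffice. *)
Lemma mpoly_congr_ind (R : comNzRingType) k
    (s : {rmorphism {mpoly R[k]} -> {mpoly R[k]}}) l :
    (forall c, exists d, c%:MP = s c%:MP + l * d) ->
    (forall i, exists d, 'X_i = s 'X_i + l * d) ->
  forall a, exists d, a = s a + l * d.
Proof.
move=> sC sX.
have sM a b : (exists d, a = s a + l * d) -> (exists d, b = s b + l * d) ->
    exists d, a * b = s (a * b) + l * d.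
  move=> [d aE] [e bE]; exists (s a * e + d * s b + l * d * e).
  by rewrite [in LHS]aE [in LHS]bE rmorphM; ring.
elim/mpolyind => [|c m p _ _ [d pE]].
  by exists 0; rewrite rmorph0 mulr0 addr0.
have [e mE] : exists e, c *: 'X_[m] = s (c *: 'X_[m]) + l * e.
  rewrite -mul_mpolyC; apply: (sM _ _ (sC c)); rewrite mpolyXE_id.
  apply: (big_ind (fun a => exists e, a = s a + l * e)) => [|//|i _].
    by exists 0; rewrite rmorph1 mulr0 addr0.
  elim: (m i) => [|j IHj]; first by exists 0; rewrite rmorph1 mulr0 addr0.
  by rewrite exprS; apply: sM (sX i) IHj.
by exists (e + d); rewrite [in LHS]mE [in LHS]pE rmorphD; ring.
Qed.

Variable R : idomainType.

Definition subst_var k (i : 'I_k) (v : {mpoly R[k]}) : {mpoly R[k]} -> {mpoly R[k]} :=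
  comp_mpoly [tuple if j == i then v else 'X_j | j < k].

HB.instance Definition _ k i v := GRing.RMorphism.copy (@subst_var k i v)
  (comp_mpoly [tuple if j == i then v else 'X_j | j < k]).

Lemma subst_varX k (i j : 'I_k) v :
  subst_var i v 'X_j = if j == i then v else 'X_j.
Proof. by rewrite /subst_var comp_mpolyXU -tnth_nth tnth_mktuple. Qed.

Lemma subst_varC k (i : 'I_k) v c : subst_var i v c%:MP = c%:MP.
Proof. exact: comp_mpolyC. Qed.

(** The hypothesis holds in particular when v does not involve X_i. *)
Lemma subst_var_retraction k (i : 'I_k) v :
  subst_var i v v = v -> retraction_mod ('X_i - v) (subst_var i v).
Proof.
move=> vv; split; first by rewrite rmorphB /= subst_varX eqxx vv subrr.
apply: mpoly_congr_ind => [c|j] /=.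
  by exists 0; rewrite subst_varC mulr0 addr0.
rewrite subst_varX; case: eqP => [->|_]; last by exists 0; rewrite mulr0 addr0.
by exists 1; rewrite mulr1 addrC subrK.
Qed.

Lemma map_retraction k (l : R) (s : {rmorphism R -> R}) :
  retraction_mod l s -> retraction_mod (l%:MP : {mpoly R[k]}) (map_mpoly s).
Proof.
move=> [sl rl]; split; first by rewrite /= map_mpolyC [X in X%:MP]sl mpolyC0.
apply: mpoly_congr_ind => [c|j].
  have [d cE] := rl c; exists d%:MP.
  by rewrite /= map_mpolyC -mpolyCM -mpolyCD; congr (_%:MP).
by exists 0; rewrite /= map_mpolyX mulr0 addr0.
Qed.

End Retractions.

(** * The syzygies of the Fermat forms *)

Notation i0 := (inord 0 : 'I_3).
Notation i1 := (inord 1 : 'I_3).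
Notation i2 := (inord 2 : 'I_3).

Lemma ord3P (i : 'I_3) : [\/ i = i0, i = i1 | i = i2].
Proof.
by case: i => [[|[|[|//]]] Hi]; [apply: Or31|apply: Or32|apply: Or33];
  apply: val_inj; rewrite /= inordK.
Qed.

Lemma eq_ord3 : ((i0 == i1) = false) * ((i1 == i0) = false) * ((i0 == i2) = false)
  * ((i2 == i0) = false) * ((i1 == i2) = false) * ((i2 == i1) = false).
Proof. by rewrite -!val_eqE /= !inordK. Qed.

Lemma big_ord3 (V : nmodType) (F : 'I_3 -> V) : \sum_(i < 3) F i = F i0 + F i1 + F i2.
Proof.
rewrite !big_ord_recl big_ord0 addr0 addrA.
by congr (F _ + F _ + F _); apply: val_inj; rewrite /= inordK.
Qed.

Lemma tnth_ord3 T (a b c : T) : (tnth [tuple a; b; c] i0 = a)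
  * (tnth [tuple a; b; c] i1 = b) * (tnth [tuple a; b; c] i2 = c).
Proof. by rewrite !(tnth_nth a) /= !inordK. Qed.

Section LinearForms.
Variable k : nat.

Definition linear_form (R : comNzRingType) (v : 'I_k -> R) : {mpoly R[k]} :=
  \sum_(i < k) (v i)%:MP * 'X_i.

Lemma mcoeff_linear_form (R : comNzRingType) (v : 'I_k -> R) i :
  (linear_form v)@_U_(i) = v i.
Proof.
rewrite /linear_form raddf_sum (bigD1 i) //= mcoeffCM mcoeffXU eqxx mulr1.
rewrite big1 ?addr0 // => j /negbTE ji.
by rewrite mcoeffCM mcoeffXU ji mulr0.
Qed.

Lemma linear_form_neq0 (R : comNzRingType) (v : 'I_k -> R) i :
  v i != 0 -> linear_form v != 0.
Proof. by apply: contraNneq => v0; rewrite -mcoeff_linear_form v0 mcoeff0. Qed.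

Lemma map_linear_form (R R' : comNzRingType) (s : {rmorphism R -> R'}) v :
  map_mpoly s (linear_form v) = linear_form (s \o v).
Proof.
rewrite /linear_form rmorph_sum; apply: eq_bigr => i _.
by rewrite rmorphM /= map_mpolyC map_mpolyX.
Qed.

Lemma subst_var0_linear_form (R : idomainType) (v : 'I_k -> R) j :
  subst_var j 0 (linear_form v) = linear_form (fun i => if i == j then 0 else v i).
Proof.
rewrite /linear_form rmorph_sum; apply: eq_bigr => i _.
rewrite rmorphM /= subst_varC subst_varX.
by case: eqP; rewrite ?mulr0 // mpolyC0 mul0r.
Qed.

End LinearForms.

Lemma bihomog_linear_form (K : fieldType) r s w d (v : 'I_s -> {mpoly K[r]}) i :
  v i != 0 -> (forall i, v i \is d.-homog) -> bihomog w (d + w) 1 (linear_form v).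
Proof.
move=> vi0 vd; split; first exact: linear_form_neq0 vi0.
move=> m; rewrite mcoeff_msupp.
suff H : (linear_form v)@_m != 0 -> exists j, m = U_(j)%MM.
  move=> /H[j ->]; rewrite mdeg1; split=> //.
  by exists d; rewrite ?muln1 // mcoeff_linear_form.
have [/existsP[j /eqP->]|Hm] := boolP [exists j, m == U_(j)%MM]; first by exists j.
rewrite /linear_form raddf_sum big1 ?eqxx // => j _.
rewrite /= mcoeffCM mcoeffX; case: eqP => [jm|]; last by rewrite mulr0.
by case/existsP: Hm; exists j; rewrite jm.
Qed.

Section Syzygies.
Variables (R : idomainType) (m : nat) (x y z : R).
Let n := m.+1.
Implicit Types (s t : {rmorphism R -> R}).

Definition syz1 : {mpoly R[3]} := linear_form (tnth [tuple y * z; x * z; x * y]).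
Definition syz2 : {mpoly R[3]} := linear_form (tnth [tuple x ^+ m; y ^+ m; z ^+ m]).
(** Stated for elements x, y, z of any domain; at the variables of K[x, y, z] these are the
    [fermat_gens] for n = m + 1, by conversion. *)
Definition fermat_forms : 'I_3 -> R :=
  tnth [tuple x * (y ^+ n - z ^+ n); y * (z ^+ n - x ^+ n); z * (x ^+ n - y ^+ n)].

Lemma coprime_to_linear_formC k (v : 'I_k -> R) (P : R) t i :
    retraction_mod P t -> P != 0 -> t (v i) != 0 ->
  coprime_to (linear_form v) P%:MP.
Proof.
move=> tP P0 tv; apply: (coprime_to_retraction (@map_retraction _ k _ _ tP)).
  by rewrite mpolyC_eq0.
by rewrite /= map_linear_form; apply: (linear_form_neq0 (i := i)).
Qed.

Lemma coprime_to_linear_formX k (v : 'I_k -> R) i j :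
  i != j -> v i != 0 -> coprime_to (linear_form v) 'X_j.
Proof.
move=> ij vi; rewrite -['X_j]subr0.
apply: (coprime_to_retraction (subst_var_retraction (rmorph0 _))).
  rewrite subr0; apply/eqP => /(congr1 (mcoeff U_(j))).
  by rewrite mcoeffX eqxx mcoeff0 => /eqP; rewrite oner_eq0.
rewrite /= subst_var0_linear_form.
by apply: (linear_form_neq0 (i := i)); rewrite (negbTE ij).
Qed.

(** Subtracting xy g2 from z^m g1 eliminates T_3 and leaves a minor. This serves twice: to put the
    minor in J, and to simplify g1 modulo a factor of f1. *)
Lemma syz_elim_z : (z ^+ m)%:MP * syz1 =
  (fermat_forms i1)%:MP * 'X_i0 - (fermat_forms i0)%:MP * 'X_i1 + (x * y)%:MP * syz2.
Proof.
rewrite /syz1 /syz2 /fermat_forms /linear_form !big_ord3 !tnth_ord3 /n !exprS.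
rewrite !(mpolyCM, mpolyCB); ring.
Qed.

Lemma syz_elim_y : (y ^+ m)%:MP * syz1 =
  (fermat_forms i0)%:MP * 'X_i2 - (fermat_forms i2)%:MP * 'X_i0 + (x * z)%:MP * syz2.
Proof.
rewrite /syz1 /syz2 /fermat_forms /linear_form !big_ord3 !tnth_ord3 /n !exprS.
rewrite !(mpolyCM, mpolyCB); ring.
Qed.

(** Once s kills f1, [syz_elim_z] reads z^m g1 = f2 T_1 + xy g2, so P = f2 T_1 and w = xy. The
    factor T_1 is coprime to g2 because the coefficient z^m of T_3 survives. *)
Lemma regular_mod_syz (l : R) s :
    retraction_mod l s -> l != 0 -> s (fermat_forms i0) = 0 -> s z != 0 ->
    coprime_to (map_mpoly s syz2) (s (fermat_forms i1))%:MP ->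
  regular_mod syz1 syz2 l%:MP.
Proof.
move=> sl l0 sf1 sz cop.
have szm : (s \o tnth [tuple x ^+ m; y ^+ m; z ^+ m]) i2 != 0.
  by rewrite /= tnth_ord3 rmorphXn expf_neq0.
apply: (@regular_mod_retraction _ _ _ _ (map_mpoly s) (s (z ^+ m))%:MP
  (s (x * y))%:MP ((s (fermat_forms i1))%:MP * 'X_i0)); rewrite /=.
- exact: map_retraction.
- by rewrite mpolyC_eq0.
- by rewrite map_linear_form; apply: linear_form_neq0 szm.
- rewrite -!map_mpolyC -rmorphM /= syz_elim_z.
  rewrite rmorphD rmorphB !rmorphM /= !map_mpolyC [X in - (X%:MP * _)]sf1 map_mpolyX.
  by rewrite mpolyC0 mul0r subr0.
- apply: coprime_toM => //; rewrite map_linear_form.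
  by apply: coprime_to_linear_formX szm; rewrite eq_ord3.
Qed.

End Syzygies.

(** * Regularity of f1 modulo the two syzygies *)

Section FermatPresentation.
Variables (K : fieldType) (m : nat).
Let n := m.+1.
Variable rs : seq K.
Hypotheses (urs : uniq rs) (size_rs : size rs = n).
Hypothesis rs_root : forall r, r \in rs -> n.-unity_root r.

Local Notation R := {mpoly K[3]}.
Local Notation x := ('X_i0 : R).
Local Notation y := ('X_i1 : R).
Local Notation z := ('X_i2 : R).
Local Notation f := (fermat_forms m x y z).

Lemma fermat_factor (a b : R) : a ^+ n - b ^+ n = \prod_(r <- rs) (a - r%:MP * b).
Proof.
rewrite -size_rs -(size_map (@mpolyC 3 K)) subrXX_prod ?big_map ?size_map ?size_rs //.
  by rewrite map_inj_uniq //; exact: can_inj (@mpolyCK _ _).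
by move=> _ /mapP[r /rs_root/unity_rootP rn ->]; rewrite -rmorphXn /= rn.
Qed.

Lemma X_neq0 (i : 'I_3) : ('X_i : R) != 0.
Proof.
apply/eqP => /(congr1 (mcoeff U_(i))).
by rewrite mcoeffX eqxx mcoeff0 => /eqP; rewrite oner_eq0.
Qed.

Lemma subX_neq0 (i j : 'I_3) (c : K) : i != j -> ('X_i : R) - c%:MP * 'X_j != 0.
Proof.
move=> ij; apply/eqP => /(congr1 (mcoeff U_(i))); rewrite mcoeffB mcoeffCM !mcoeffXU.
by rewrite eqxx eq_sym (negbTE ij) mulr0 subr0 mcoeff0 => /eqP; rewrite oner_eq0.
Qed.

Lemma subr_expn_neq0 (i j : 'I_3) : i != j -> ('X_i : R) ^+ n - 'X_j ^+ n != 0.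
Proof.
move=> ij; rewrite fermat_factor prodf_seq_neq0.
by apply/allP => r _; rewrite /= subX_neq0.
Qed.

Lemma subX_retraction (i j : 'I_3) (c : K) : i != j ->
  retraction_mod ('X_i - c%:MP * 'X_j : R) (subst_var i (c%:MP * 'X_j)).
Proof.
move=> ij; apply: subst_var_retraction.
by rewrite rmorphM /= subst_varC subst_varX eq_sym (negbTE ij).
Qed.

(** It is enough that one coefficient X_k^m of g2 survives s followed by X_i := c X_j. *)
Lemma coprime_to_syz2C (s : {rmorphism R -> R}) i j k (c : K) :
    i != j -> subst_var i (c%:MP * 'X_j) (s 'X_k) != 0 ->
  coprime_to (map_mpoly s (syz2 m x y z)) ('X_i - c%:MP * 'X_j : R)%:MP.
Proof.
move=> ij sk; rewrite map_linear_form.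
apply: (coprime_to_linear_formC (i := k) (subX_retraction _ ij) (subX_neq0 _ ij)).
have E : tnth [tuple x ^+ m; y ^+ m; z ^+ m] k = 'X_k ^+ m.
  by case: (ord3P k) => ->; rewrite tnth_ord3.
by rewrite [_ k]/= E !rmorphXn expf_neq0.
Qed.

Lemma coprime_to_syz2X (s : {rmorphism R -> R}) i k :
  subst_var i 0 (s 'X_k) != 0 -> coprime_to (map_mpoly s (syz2 m x y z)) ('X_i : R)%:MP.
Proof.
have [j ij] : exists j, i != j.
  by case: (ord3P i) => ->; [exists i1 | exists i0 | exists i0]; rewrite eq_ord3.
move=> sk; have := @coprime_to_syz2C s i j k 0 ij.
by rewrite mpolyC0 mul0r subr0; apply.
Qed.

Lemma regular_mod_syz_form : regular_mod (syz1 x y z) (syz2 m x y z) (f i0)%:MP.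
Proof.
have ne := eq_ord3.
have var (i j : 'I_3) (c : K) : subst_var i (c%:MP * 'X_j) 'X_i = c%:MP * 'X_j :> R.
  by rewrite subst_varX eqxx.
have nvar (i j k : 'I_3) (c : K) : (k == i) = false ->
    subst_var i (c%:MP * 'X_j) 'X_k = 'X_k :> R.
  by rewrite subst_varX => ->.
have nvar0 (i k : 'I_3) : (k == i) = false -> subst_var i 0 'X_k = 'X_k :> R.
  by rewrite subst_varX => ->.
have sf1E (s : {rmorphism R -> R}) :
    s (f i1) = s y * \prod_(r <- rs) (s z - s r%:MP * s x).
  rewrite /fermat_forms tnth_ord3 fermat_factor rmorphM rmorph_prod; congr (_ * _).
  by apply: eq_bigr => r _; rewrite rmorphB rmorphM.
rewrite /fermat_forms tnth_ord3 fermat_factor mpolyCM rmorph_prod.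
apply: regular_modM; last first.
  (* For a factor y - r z, the retraction is y := r z; it kills f1 because r^n = 1. *)
  rewrite big_seq.
  apply: big_ind => [||r rrs]; [exact: regular_mod1 | exact: regular_modM |].
  have /unity_rootP rn := rs_root rrs.
  have r0 : r != 0.
    by apply: contra_eq_neq rn => ->; rewrite expr0n eq_sym oner_eq0.
  apply: (@regular_mod_syz _ _ _ _ _ _ (subst_var i1 (r%:MP * z))) => /=.
  - by apply: subX_retraction; rewrite ne.
  - by apply: subX_neq0; rewrite ne.
  - rewrite /fermat_forms tnth_ord3 !rmorphM rmorphB !rmorphXn /= var !nvar ?ne //.
    by rewrite exprMn -rmorphXn /= rn mpolyC1 mul1r subrr mulr0.
  - by rewrite nvar ?ne // X_neq0.
  - rewrite sf1E /= var !nvar ?ne // rmorphM rmorph_prod /= mpolyCM.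
    (* Under y := r z, f2 becomes r z times the product of the z - r' x. Here r is a unit, and x
       survives both z := 0 and z := r' x. *)
    apply: coprime_toM; first apply: coprime_toM.
    + by apply: coprime_to_unit; rewrite !rmorph_unit // unitfE.
    + apply: (@coprime_to_syz2X (subst_var i1 (r%:MP * z)) i2 i0).
      by rewrite /= nvar ?nvar0 ?ne // X_neq0.
    + apply: coprime_to_prod => r'; rewrite subst_varC.
      apply: (@coprime_to_syz2C (subst_var i1 (r%:MP * z)) i2 i0 i0).
      * by rewrite ne.
      * by rewrite /= !nvar ?ne // X_neq0.
(* For the factor x, the retraction is x := 0. Then f2 becomes y times a power of z; z survives y :=
   0, and y survives z := 0. *)
have var0 (i : 'I_3) : subst_var i 0 'X_i = 0 :> R by rewrite subst_varX eqxx.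
apply: (@regular_mod_syz _ _ _ _ _ _ (subst_var i0 0)) => /=.
- by rewrite -[x]subr0; apply: subst_var_retraction; rewrite rmorph0.
- exact: X_neq0.
- by rewrite /fermat_forms tnth_ord3 rmorphM /= var0 mul0r.
- by rewrite nvar0 ?ne // X_neq0.
- rewrite sf1E /= var0 !nvar0 ?ne // rmorphM rmorph_prod /=.
  apply: coprime_toM.
    apply: (@coprime_to_syz2X (subst_var i0 0) i1 i2).
    by rewrite /= !nvar0 ?ne // X_neq0.
  apply: coprime_to_prod => r'; rewrite mulr0 subr0.
  apply: (@coprime_to_syz2X (subst_var i0 0) i2 i1).
  by rewrite /= !nvar0 ?ne // X_neq0.
Qed.

End FermatPresentation.

(** * The two syzygies generate the kernel *)

Lemma alg_ker_comb (A : comNzRingType) k (h : 'I_k -> {poly A}) a b p q :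
  p \in alg_ker h -> q \in alg_ker h -> a * p + b * q \in alg_ker h.
Proof.
rewrite !inE rmorphD !rmorphM /= => /eqP-> /eqP->.
by rewrite !mulr0 addr0.
Qed.

Lemma alg_map_linear_form (A : comNzRingType) k (h v : 'I_k -> A) :
  alg_map (rees_gens h) (linear_form v) = (\sum_(i < k) v i * h i) *: 'X.
Proof.
rewrite /linear_form rmorph_sum scaler_suml; apply: eq_bigr => i _.
by rewrite rmorphM /= alg_mapC alg_mapX mul_polyC scalerA.
Qed.

Section SyzygiesKernel.
Variables (R : idomainType) (m : nat) (x y z : R).
Local Notation f := (fermat_forms m x y z).
Local Notation g1 := (syz1 x y z).
Local Notation g2 := (syz2 m x y z).
Local Notation L := (alg_ker (rees_gens f)).

Lemma syz1_in_ker : g1 \in L.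
Proof.
rewrite inE alg_map_linear_form big_ord3 /fermat_forms !tnth_ord3.
by apply/eqP; rewrite [X in X *: _](_ : _ = 0) ?scale0r //; ring.
Qed.

Lemma syz2_in_ker : g2 \in L.
Proof.
rewrite inE alg_map_linear_form big_ord3 /fermat_forms !tnth_ord3.
by apply/eqP; rewrite [X in X *: _](_ : _ = 0) ?scale0r // !exprS; ring.
Qed.

Lemma minors_in_syz i : ideal_gen (fun g => g \in [:: g1; g2])
  ((f i0)%:MP * 'X_i - (f i)%:MP * 'X_i0).
Proof.
apply/ideal_gen2P; case: (ord3P i) => ->.
- by exists 0, 0; rewrite subrr !mul0r addr0.
- exists (- (z ^+ m)%:MP), (x * y)%:MP; rewrite mulNr syz_elim_z; ring.
- exists (y ^+ m)%:MP, (- (x * z)%:MP); rewrite syz_elim_y; ring.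
Qed.

Lemma syz_kernel p : regular_mod g1 g2 (f i0)%:MP ->
  p \in L <-> ideal_gen (fun g => g \in [:: g1; g2]) p.
Proof.
move=> reg; split; last first.
  move=> /ideal_gen2P[a [b ->]].
  by apply: alg_ker_comb; [exact: syz1_in_ker | exact: syz2_in_ker].
move=> /(rees_kernel_saturated minors_in_syz)[N].
rewrite !ideal_gen2P; elim: N => [|N IHN]; first by rewrite mul1r.
by rewrite exprS -mulrA => H; apply: IHN; apply: reg.
Qed.

End SyzygiesKernel.

Section Kernel.
Variables (K : fieldType) (m : nat).
Let n := m.+1.
Variable rs : seq K.
Hypotheses (urs : uniq rs) (size_rs : size rs = n).
Hypothesis rs_root : forall r, r \in rs -> n.-unity_root r.

Local Notation R := {mpoly K[3]}.
Local Notation S := {mpoly {mpoly K[3]}[3]}.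
Local Notation x := ('X_i0 : R).
Local Notation y := ('X_i1 : R).
Local Notation z := ('X_i2 : R).
Local Notation f := (fermat_forms m x y z).
Local Notation g1 := (syz1 x y z).
Local Notation g2 := (syz2 m x y z).
Local Notation L := (alg_ker (fermat_rees_gens K n)).

Lemma fermat_kernel p :
  p \in L <-> ideal_gen (fun g => g \in [:: g1; g2]) p.
Proof. exact: syz_kernel (regular_mod_syz_form urs size_rs rs_root). Qed.

Lemma bihomog_syz1 : bihomog n.+1 (n + 3) 1 g1.
Proof.
(* The coefficients are quadratic and T_i has weight n + 1. *)
have -> : (n + 3 = 2 + n.+1)%N by rewrite addnC.
have hX i : ('X_i : R) \is 1.-homog by rewrite dhomogX /= mdeg1.
apply: (@bihomog_linear_form _ _ _ _ _ _ i0).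
  by rewrite tnth_ord3 mulf_neq0 // X_neq0.
by move=> i; case: (ord3P i) => ->; rewrite tnth_ord3; apply: (dhomogM (hX _) (hX _)).
Qed.

Lemma bihomog_syz2 : bihomog n.+1 (2 * n) 1 g2.
Proof.
have -> : (2 * n = m + n.+1)%N by rewrite mul2n -addnn addSnnS.
have hX i : ('X_i ^+ m : R) \is m.-homog.
  by rewrite mpolyXn dhomogX /= mdegMn mdeg1 mul1n.
apply: (@bihomog_linear_form _ _ _ _ _ _ i0).
  by rewrite tnth_ord3 expf_neq0 // X_neq0.
by move=> i; case: (ord3P i) => ->; rewrite tnth_ord3.
Qed.

End Kernel.

(** * Heights *)

Section LinearDependence.
Variable R : idomainType.

(* Fraction-free elimination of the last coordinate with pivot row p. *)
Lemma linear_dependence_ord n m (v : 'I_m -> nat -> R) : (n < m)%N ->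
  exists2 c : 'I_m -> R, exists i, c i != 0 &
    forall j, (j < n)%N -> \sum_(i < m) c i * v i j = 0.
Proof.
elim: n m v => [|n IHn] [//|m] v nm.
  by exists (fun=> 1) => //; exists ord0; apply: oner_neq0.
have [p pP] : exists p, v p n = 0 -> forall i, v i n = 0.
  have [/forallP v0|/forallPn[p vp]] := boolP [forall i, v i n == 0].
    by exists ord0 => _ i; apply/eqP.
  by exists p => vp0; rewrite vp0 eqxx in vp.
(* If the pivot entry is 0 then the whole column is, and 1 replaces it to keep e nonzero. *)
pose e := if v p n == 0 then 1 else v p n.
have e0 : e != 0 by rewrite /e; case: ifP => [_|/negbT//]; apply: oner_neq0.
have [c' [k0 ck0] c'P] := IHn m
  (fun k j => e * v (lift p k) j - v (lift p k) n * v p j) nm.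
(* These are the coefficients of the c'-combination of the reduced rows, expanded in the original
   rows; the pivot row collects all the subtracted terms. *)
pose c i := if unlift p i is Some k then c' k * e
            else - \sum_k c' k * v (lift p k) n.
exists c; first by exists (lift p k0); rewrite /c liftK mulf_neq0.
have sumE j : \sum_i c i * v i j
    = \sum_k c' k * (e * v (lift p k) j - v (lift p k) n * v p j).
  rewrite (bigD1_ord p) //= {1}/c unlift_none mulNr mulr_suml -sumrN -big_split /=.
  by apply: eq_bigr => k _; rewrite /c liftK; ring.
move=> j; rewrite ltnS leq_eqVlt sumE => /orP[/eqP->|/c'P//].
apply: big1 => k _; rewrite /e; case: ifP => [/eqP/pP->|_]; last by ring.
by rewrite mulr0 mul0r subr0 mulr0.
Qed.

Lemma linear_dependence (I : finType) (n : nat) (v : I -> nat -> R) : (n < #|I|)%N ->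
  exists2 c : I -> R, exists i, c i != 0 &
    forall j, (j < n)%N -> \sum_i c i * v i j = 0.
Proof.
move=> /(linear_dependence_ord (fun i => v (enum_val i)))[c [i0 ci0] cP].
exists (c \o enum_rank) => [|j /cP cj].
  by exists (enum_val i0); rewrite /= enum_valK.
rewrite (reindex (@enum_val I I)) /=; first apply: etrans cj.
  by apply: eq_bigr => i _; rewrite enum_valK.
by exists enum_rank => i _; [exact: enum_valK | exact: enum_rankK].
Qed.

End LinearDependence.

Section MsizeBounds.
Variables (R : idomainType) (k : nat).
Implicit Types p q : {mpoly R[k]}.

Lemma msizeM_bound p q d e :
  (msize p <= d.+1)%N -> (msize q <= e.+1)%N -> (msize (p * q) <= (d + e).+1)%N.
Proof.
have [->|p0] := eqVneq p 0; first by rewrite mul0r msize0.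
have [->|q0] := eqVneq q 0; first by rewrite mulr0 msize0.
move=> pd qe; rewrite msizeM // -ltnS prednK; last first.
  by rewrite addn_gt0 lt0n msize_poly_eq0 p0.
by rewrite (leq_trans (leq_add pd qe)) // addSn addnS.
Qed.

Lemma msizeX_bound p d i : (msize p <= d.+1)%N -> (msize (p ^+ i) <= (i * d).+1)%N.
Proof.
move=> pd; elim: i => [|i IHi]; first by rewrite expr0 msize1.
by rewrite exprS mulSn; apply: msizeM_bound.
Qed.

End MsizeBounds.

(** * Algebraic dependence of four polynomials in three variables *)

Section AlgebraicDependence.
Variable R : idomainType.
Local Notation S := {mpoly R[3]}.

(** A dimension count: the M^4 products of powers with exponents below M have degree O(M), so they
    involve only O(M^3) monomials and are linearly dependent over R for M large. *)
Lemma algebraic_dependence (a b c d : S) : exists M : nat,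
  exists2 h : 'I_M * 'I_M * ('I_M * 'I_M) -> R, exists t, h t != 0 &
  \sum_t (h t)%:MP * (a ^+ t.1.1 * b ^+ t.1.2 * (c ^+ t.2.1 * d ^+ t.2.2)) = 0.
Proof.
(* D bounds the four degrees, and N = 4 M D + 1 bounds the sizes of the products. Since N <= 5 D M,
   choosing M > 125 D^3 gives N^3 < M^4. *)
pose D := (msize a + msize b + msize c + msize d).+1.
pose M := (125 * D ^ 3).+1; exists M.
pose N := (4 * M * D).+1.
pose F (t : 'I_M * 'I_M * ('I_M * 'I_M)) :=
  a ^+ t.1.1 * b ^+ t.1.2 * (c ^+ t.2.1 * d ^+ t.2.2).
have sF t : (msize (F t) <= N)%N.
  have H (p : S) (i : 'I_M) : (msize p <= D)%N -> (msize (p ^+ i) <= (M * D).+1)%N.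
    move=> /leqW/(msizeX_bound i)/leq_trans; apply.
    by rewrite ltnS leq_mul2r (ltnW (ltn_ord i)) orbT.
  have -> : N = (M * D + M * D + (M * D + M * D)).+1 by rewrite /N; lia.
  do 2!apply: msizeM_bound; try (apply: msizeM_bound); apply: H; rewrite /D; lia.
(* The N^3 monomials with exponents below N include all those of degree below N. *)
pose s := [seq [multinom (j i : nat) | i < 3] | j : {ffun 'I_3 -> 'I_N}].
have sP m : m \notin s -> (N <= mdeg m)%N.
  apply: contraNleq => mN; apply/mapP.
  have lt i : (m i < N)%N.
    by apply: leq_ltn_trans mN; rewrite mdegE (bigD1 i) //= leq_addr.
  exists [ffun i => Ordinal (lt i)]; first by rewrite mem_enum.
  by apply/mnmP => i; rewrite mnmE ffunE.
have ss : size s = (N ^ 3)%N by rewrite size_map -cardE card_ffun !card_ord.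
have lt : (size s < #|{: 'I_M * 'I_M * ('I_M * 'I_M)}|)%N.
  rewrite ss !card_prod !card_ord.
  have : (N <= 5 * D * M)%N by rewrite /N /D; nia.
  rewrite -(leq_exp2r _ _ (isT : (0 < 3)%N)) => H; apply: leq_ltn_trans H _.
  rewrite !expnMn {2}/M; nia.
have [h h0 hP] := linear_dependence (fun t j => (F t)@_(nth 0%MM s j)) lt.
exists h => //; apply/mpolyP => m; rewrite mcoeff0 raddf_sum /=.
under eq_bigr do rewrite mcoeffCM.
have [ms|/sP mN] := boolP (m \in s).
  by rewrite -(nth_index 0%MM ms); apply: hP; rewrite index_mem.
apply: big1 => t _; rewrite [X in _ * X]memN_msupp_eq0 ?mulr0 //.
by apply: msize_mdeg_ge; apply: leq_trans (sF t) mN.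
Qed.

End AlgebraicDependence.

Lemma ker_prime (A : comNzRingType) (B : idomainType) (h : {rmorphism A -> B}) :
  prime_ideal [pred a | h a == 0].
Proof.
split; last first.
  by move=> u v; rewrite !inE rmorphM mulf_eq0.
split=> [||a u v]; rewrite ?inE ?rmorph0 ?rmorph1 ?oner_eq0 //.
by move=> /eqP hu /eqP hv; rewrite rmorphD rmorphM hu hv mulr0 addr0.
Qed.

(** * Algebraic independence along a chain of primes, and the upper bound for the height *)

Section Extension.
Variables (A S : comNzRingType) (e : {rmorphism A -> S}) (a : S).

(** The extension of e to A[X] that sends X to a. Iterating it evaluates nested univariate
    polynomials at several elements, so algebraic independence modulo a prime is injectivity of such
    a map modulo that prime. *)
Definition extend_morph : {poly A} -> S := horner_eval a \o map_poly e.
HB.instance Definition _ :=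
  GRing.RMorphism.copy extend_morph (horner_eval a \o map_poly e).

Lemma extend_morphC c : extend_morph c%:P = e c.
Proof. by rewrite /extend_morph /= map_polyC /horner_eval hornerC. Qed.

Lemma extend_morphX : extend_morph 'X = a.
Proof. by rewrite /extend_morph /= map_polyX /horner_eval hornerX. Qed.

Lemma extend_morph_poly n (E : nat -> A) :
  extend_morph (\poly_(i < n) E i) = \sum_(i < n) e (E i) * a ^+ i.
Proof.
rewrite poly_def rmorph_sum; apply: eq_bigr => i _.
by rewrite -mul_polyC rmorphM rmorphXn /= extend_morphX extend_morphC.
Qed.

(* Transcendence degree drops along a strict inclusion of primes C < C':
   an element of C' outside C is transcendental over what is independent mod C'. *)
Lemma extend_morph_inj (C C' : {pred S}) :
    prime_ideal C -> prime_ideal C' -> {subset C <= C'} -> a \in C' -> a \notin C ->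
    (forall c, e c \in C' -> c = 0) ->
  forall F, extend_morph F \in C -> F = 0.
Proof.
move=> [_ Cprime] [[C'0 _ C'lin] _] sCC' aC' aC einj.
elim/poly_ind => [//|F c IHF] FC.
rewrite rmorphD rmorphM /= extend_morphX extend_morphC in FC.
(* Since a is in C', the value of F X + c is congruent to e c modulo C'. *)
have c0 : c = 0.
  apply: einj; have -> : e c = - extend_morph F * a + (extend_morph F * a + e c) by ring.
  by apply: C'lin => //; apply: sCC'.
rewrite c0 addr0; rewrite c0 rmorph0 addr0 in FC.
case/orP: (Cprime _ _ FC) => [/IHF->|]; last by rewrite (negbTE aC).
by rewrite mul0r.
Qed.

End Extension.

Section Heights.
Variable (R : idomainType).
Local Notation S := {mpoly R[3]}.

Lemma height_alg_ker_lt3 (f : 'I_3 -> R) : f i0 != 0 ->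
  ~ height_prime_ge (alg_ker (rees_gens f)) 3.
Proof.
move=> f0 [C [Cp Cs CL]].
have [s0 [a1 a1C a1N]] := Cs 0%N isT.
have [s1 [a2 a2C a2N]] := Cs 1%N isT.
have [s2 [a3 a3C a3N]] := Cs 2%N isT.
(* The Rees map sends T_1 to [f i0] t with [f i0] nonzero, so T_1 is transcendental over R modulo L.
   Each step down the chain then adds one independent element. *)
pose e0 := extend_morph (@mpolyC 3 R) 'X_i0.
have e0inj F : e0 F \in C 3%N -> F = 0.
  rewrite CL inE => /eqP E; apply/eqP.
  have s2X : size (f i0 *: 'X : {poly R}) = 2%N by rewrite size_scale // size_polyX.
  rewrite -(comp_poly2_eq0 _ s2X) -E; apply/eqP.
  rewrite /e0 /extend_morph /= /horner_eval; elim/poly_ind: F {E} => [|F c IHF].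
    by rewrite comp_poly0 !rmorph0 horner0 rmorph0.
  rewrite comp_poly_MXaddC IHF rmorphD rmorphM /= map_polyX map_polyC !hornerE.
  by rewrite rmorphD rmorphM /= alg_mapX alg_mapC.
pose e1 := extend_morph e0 a3.
have e1inj := extend_morph_inj (Cp 2%N isT) (Cp 3%N isT) s2 a3C a3N e0inj.
pose e2 := extend_morph e1 a2.
have e2inj := extend_morph_inj (Cp 1%N isT) (Cp 2%N isT) s1 a2C a2N e1inj.
pose e3 := extend_morph e2 a1.
have e3inj := extend_morph_inj (Cp 0%N isT) (Cp 1%N isT) s0 a1C a1N e2inj.
(* The dependence yields a nonzero nested polynomial whose value 0 lies in [C 0], against
   [e3inj]. *)
have [M [h [[[i j] [k l]] h0] hE]] := algebraic_dependence a1 a2 a3 'X_i0.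
have C0 : 0 \in C 0%N by case: (Cp 0%N isT) => [[]].
(* [H] extends h by 0, since coefficients of polynomials are indexed by all naturals. In F below the
   outermost variable stands for [a1] and the innermost for T_1. *)
pose H (a b c d : nat) := if (insub a, insub b, insub c, insub d) is
  (Some a, Some b, Some c, Some d) then h (a, b, (c, d)) else 0.
have HE (a b c d : 'I_M) : H a b c d = h (a, b, (c, d)) by rewrite /H !valK.
pose F := \poly_(i < M) \poly_(j < M) \poly_(k < M) \poly_(l < M) H i j k l.
have F0 : F = 0.
  apply: e3inj; rewrite -/e3 [e3 F](_ : _ = 0) //.
  pose G (i j k l : 'I_M) := (h (i, j, (k, l)))%:MP *
    (a1 ^+ i * a2 ^+ j * (a3 ^+ k * 'X_i0 ^+ l)).
  transitivity (\sum_i \sum_j \sum_k \sum_l G i j k l); last first.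
    rewrite -[RHS]hE pair_bigA /=; under eq_bigr do rewrite pair_bigA.
    by rewrite pair_bigA; apply: eq_bigr => [[[? ?] [? ?]] _].
  have mulE (p a b c d : S) : p * d * c * b * a = p * (a * b * (c * d)) by ring.
  rewrite /e3 extend_morph_poly; apply: eq_bigr => i' _.
  rewrite /= /e2 extend_morph_poly mulr_suml; apply: eq_bigr => j' _.
  rewrite /= /e1 extend_morph_poly !mulr_suml; apply: eq_bigr => k' _.
  rewrite /= /e0 extend_morph_poly !mulr_suml; apply: eq_bigr => l' _.
  by rewrite HE; apply: mulE.
have := congr1 (fun G : {poly {poly {poly {poly R}}}} => G`_i`_j`_k`_l) F0.
rewrite /F /=; do 4!rewrite coef_poly ltn_ord.
rewrite HE !coef0 => E.
by rewrite E eqxx in h0.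
Qed.

End Heights.

(** * Lower bound for the height *)

Lemma alg_map_comp (A : comNzRingType) k k' (a : 'I_k' -> {poly A})
    (h : 'I_k -> {poly A}) (lq : k.-tuple {mpoly A[k']}) p :
  (forall i, alg_map a (tnth lq i) = h i) -> alg_map a (p \mPo lq) = alg_map h p.
Proof.
move=> ha; elim/mpolyind: p => [|c mm p _ _ IHp]; first by rewrite !rmorph0.
rewrite !rmorphD /= IHp; congr (_ + _).
rewrite comp_mpolyZ !alg_mapZ comp_mpolyX rmorph_prod /=; congr (_ * _).
rewrite [RHS]mmapX; apply: eq_bigr => i _.
by rewrite rmorphXn /= ha.
Qed.

Section HeightLowerBound.
Variables (R : idomainType) (m : nat) (x y z : R).
Let n := m.+1.
Local Notation S := {mpoly R[3]}.
Local Notation f := (fermat_forms m x y z).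
Local Notation L := (alg_ker (rees_gens f)).

Definition syz1_param : 3.-tuple S :=
  [tuple x%:MP * 'X_i0; y%:MP * 'X_i1; - z%:MP * ('X_i0 + 'X_i1)].

(** The Rees map factors through the parametrization, so Q lies in L. *)
Lemma syz1_param_sub p : p \mPo syz1_param = 0 -> p \in L.
Proof.
(* With s = (y^n - z^n) X and t = (z^n - x^n) X, -(s + t) is (x^n - y^n) X. The parametrization
   involves only s and t, so the third value is set to 0. *)
pose a := tnth [tuple (y ^+ n - z ^+ n) *: 'X; (z ^+ n - x ^+ n) *: 'X; 0 : {poly R}].
have ha i : alg_map a (tnth syz1_param i) = rees_gens f i.
  rewrite /syz1_param /rees_gens /fermat_forms; case: (ord3P i) => ->; rewrite !tnth_ord3.
  - by rewrite rmorphM /= alg_mapC alg_mapX /a tnth_ord3 mul_polyC scalerA.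
  - by rewrite rmorphM /= alg_mapC alg_mapX /a tnth_ord3 mul_polyC scalerA.
  - rewrite rmorphM rmorphN rmorphD /= alg_mapC !alg_mapX /a !tnth_ord3.
    by rewrite -!mul_polyC !(polyCM, polyCB); ring.
by rewrite inE -(alg_map_comp _ ha) => ->; rewrite rmorph0.
Qed.

Lemma comp_syz1_param (v : 'I_3 -> R) : linear_form v \mPo syz1_param =
  linear_form (tnth [tuple v i0 * x - v i2 * z; v i1 * y - v i2 * z; 0]).
Proof.
rewrite /linear_form rmorph_sum !big_ord3 !rmorphM /= !comp_mpolyC !comp_mpolyXU.
rewrite -!tnth_nth !tnth_ord3 !(mpolyCM, mpolyCB) mpolyC0; ring.
Qed.

(** In the chain 0 < Q < P, the nonzero g1 lies in Q, while g2 lies in L, hence in P, but not in Q: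
    after parametrization its coefficient of s is x^n - z^n. *)
Lemma height_ge2_syz (P : {pred S}) :
    x != 0 -> y != 0 -> x ^+ n != z ^+ n -> prime_ideal P -> {subset L <= P} ->
  height_prime_ge P 2.
Proof.
move=> x0 y0 xz Pp LP.
exists (fun i => match i return {pred S} with
  | 0%N => [pred p : S | p == 0]
  | 1%N => [pred p : S | p \mPo syz1_param == 0]
  | _ => P end); split=> // [[|[|[|//]]]|[|[|//]]] // _.
- exact: (ker_prime idfun).
- exact: (ker_prime (comp_mpoly syz1_param)).
- split=> [p|]; first by rewrite !inE => /eqP->; rewrite comp_mpoly0.
  exists (syz1 x y z); rewrite inE.
    apply/eqP; rewrite comp_syz1_param !tnth_ord3.
    rewrite /linear_form big_ord3 !tnth_ord3 mpolyC0 mul0r addr0.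
    have -> : y * z * x - x * y * z = 0 by ring.
    have -> : x * z * y - x * y * z = 0 by ring.
    by rewrite !mpolyC0 !mul0r addr0.
  by apply: (linear_form_neq0 (i := i2)); rewrite tnth_ord3 mulf_neq0.
- split=> [p|]; first by rewrite inE => /eqP/syz1_param_sub/LP.
  exists (syz2 m x y z); first by apply/LP/syz2_in_ker.
  rewrite inE comp_syz1_param; apply: (linear_form_neq0 (i := i0)).
  by rewrite !tnth_ord3 -!exprSr subr_eq0.
Qed.

Lemma height_syz : x != 0 -> y != 0 -> x ^+ n != z ^+ n -> f i0 != 0 -> height_eq L 2.
Proof.
move=> x0 y0 xz f0; split=> [P Pp LP|]; first exact: height_ge2_syz.
(* L is itself prime, as the kernel of a map to a domain. *)
exists L; split=> //; last exact: height_alg_ker_lt3.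
exact: (ker_prime (alg_map (rees_gens f))).
Qed.

End HeightLowerBound.

Theorem corollary2p4 (n : nat) (hn : (2 <= n)%N) (K : fieldType)
  (hK : exists rs : seq K,
      [/\ uniq rs, size rs = n & forall r, r \in rs -> n.-unity_root r]) :
  let L : {pred {mpoly {mpoly K[3]}[3]}} := alg_ker (fermat_rees_gens K n) in
  [/\ presents (fermat_rees_gens K n) (rees_algebra (fermat_ideal K n)),
      complete_intersection (rees_algebra (fermat_ideal K n)),
      exists g1 g2 : {mpoly {mpoly K[3]}[3]},
        [/\ bihomog n.+1 (n + 3) 1 g1,
            bihomog n.+1 (2 * n) 1 g2
          & forall p, p \in L <-> ideal_gen (fun g => g \in [:: g1; g2]) p]
    & height_eq L 2].
Proof.
case: n hn hK => // m _ [rs [urs srs rsP]] L.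
have LP := fermat_kernel urs srs rsP.
have f0 := subr_expn_neq0 urs srs rsP.
have LH : height_eq L 2.
  apply: height_syz; rewrite ?X_neq0 //.
    by rewrite -subr_eq0 f0 // eq_ord3.
  by rewrite /fermat_forms tnth_ord3 mulf_neq0 ?X_neq0 // f0 // eq_ord3.
have pres := presents_rees (fermat_gens K m.+1).
split=> //.
  by exists 3%N, (fermat_rees_gens K m.+1),
    [:: syz1 'X_i0 'X_i1 'X_i2; syz2 m 'X_i0 'X_i1 'X_i2].
exists (syz1 'X_i0 'X_i1 'X_i2), (syz2 m 'X_i0 'X_i1 'X_i2).
by split=> //; [exact: bihomog_syz1 | exact: bihomog_syz2].
Qed.
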